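(* There exists an absolute constant $c$ such that the following holds. Let $\mathfrak{L}_1,\mathfrak{L}_2,\mathfrak{L}_3$ be finite collections of $L_1$, $L_2$ and $L_3$, respectively, lines in $\mathbb{R}^3$, such that, whenever a line of $\mathfrak{L}_1$, a line of $\mathfrak{L}_2$ and a line of $\mathfrak{L}_3$ meet at a point, they form a joint there (i.e. their directions span $\mathbb{R}^3$). Let $J$ be the set of multijoints formed by $\mathfrak{L}_1,\mathfrak{L}_2$ and $\mathfrak{L}_3$, and let $m\in\{1,2,3\}$ be such that $L_m=\min\{L_1,L_2,L_3\}$. Then $$\sum_{\{x\in J:\; N_m(x)>10^{12}\}} (N_1(x)N_2(x)N_3(x))^{1/2} \leq c\cdot (L_1L_2L_3)^{1/2}.$$
   Context: A collection of lines is a set of distinct lines (each line is contained only once). A point $x\in\mathbb{R}^3$ is a multijoint formed by $\mathfrak{L}_1,\mathfrak{L}_2,\mathfrak{L}_3$ if for each $i=1,2,3$ there exists a line $l_i\in\mathfrak{L}_i$ with $x\in l_i$, such that the directions of $l_1,l_2,l_3$ span $\mathbb{R}^3$. For $x\in J$ and $i=1,2,3$, $N_i(x)$ denotes the number of lines of $\mathfrak{L}_i$ passing through $x$. *)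

(* Defs.v *)
From HB Require Import structures.
From mathcomp Require Import all_boot all_order all_algebra finmap.
From mathcomp Require Import all_classical all_reals.

Set Implicit Arguments.
Unset Strict Implicit.
Unset Printing Implicit Defensive.

Import Order.TTheory GRing.Theory Num.Theory.

Local Open Scope fset_scope.
Local Open Scope classical_set_scope.
Local Open Scope ring_scope.

Section Multijoints.
Context {R : realType}.
Local Notation point := 'rV[R]_3.

Definition is_direction (l : set point) (v : point) : Prop :=
  v != 0 /\ exists p : point, l = [set p + t *: v | t in [set: R]].

Definition is_line (l : set point) : Prop := exists v, is_direction l v.

Definition directions_span (l : 'I_3 -> set point) : Prop :=
  exists v : 'I_3 -> point,
    (forall i, is_direction (l i) (v i)) /\
    <<[tuple v i | i < 3]>>%VS = fullv.

(* The three collections of lines are indexed by 'I_3; they need not be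
   disjoint from one another. *)
Definition multijoint (L : 'I_3 -> {fset set point}) (x : point) : Prop :=
  exists l : 'I_3 -> set point,
    [/\ forall i, l i \in L i, forall i, l i x & directions_span l].

Definition nlines (A : {fset set point}) (x : point) : nat :=
  #|` [fset l in A | x \in l]|.

(* A finitely supported sum \sum_(x \in A) is 0 by convention on infinite
   supports; this lemma shows that sums over multijoints avoid that case. *)
Lemma finite_multijoint (L : 'I_3 -> {fset set point}) :
  finite_set (multijoint L).
Proof.
pose i0 : 'I_3 := ord0; pose i1 : 'I_3 := ord_max.
pose f (a : set point * set point) := xget 0 (a.1 `&` a.2).
apply: (@sub_finite_set _ _ (f @` ([set` L i0] `*` [set` L i1]))); last first.
  by apply: finite_image; apply: finite_setX; exact: finite_fset.
move=> x [l [lL lx [v [dv sv]]]].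
exists (l i0, l i1); first by split; exact: lL.
have [y0 y1] : (l i0 `&` l i1) (f (l i0, l i1)).
  by apply: (@xgetPex _ 0 (l i0 `&` l i1)); exists x; split; exact: lx.
move: (f _) y0 y1 => y y0 y1.
apply/eqP; rewrite -subr_eq0.
have diff i : l i y -> exists t, y - x = t *: v i.
  have [_ [p lE]] := dv i; move: (lx i); rewrite lE => -[s _ <-] [t _ <-].
  by exists (t - s); rewrite scalerBl opprD addrACA subrr add0r.
have [s sE] := diff _ y0; have [t tE] := diff _ y1.
have fr : free [tuple v i | i < 3].
  by rewrite /free sv dimvf size_tuple.
pose k (i : 'I_3) : R := if i == i0 then s else if i == i1 then - t else 0.
have kE (i : 'I_3) : [tuple v i | i < 3]`_i = v i by rewrite -tnth_nth tnth_mktuple.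
suff s0 : s = 0 by rewrite sE s0 scale0r.
move/freeP: fr => /(_ k)/(_ _ i0); apply.
under eq_bigr do rewrite kE.
rewrite (bigD1 i0) //= (bigD1 i1) //= big1 ?addr0.
  by rewrite /k /= -sE scaleNr -tE subrr.
by move=> i /andP[/negbTE i_i0 /negbTE i_i1]; rewrite /k i_i0 i_i1 scale0r.
Qed.

End Multijoints.

(* Main.v *)
(* Polynomial method with handicaps, after Tidor, Yu and Zhao. Fix a degree [n]
   and a function [beta] on the points. On a line [l] let [t] be the largest
   integer with [\sum_(q on l) (t - beta q) <= n] (truncated subtraction), and
   let [B_p(l) = t + 1 - beta p]. Choosing at each point [p] one line from each
   family, no nonzero polynomial of degree at most [n] can have all its mixed
   derivatives of order [(a, b, c)] at [p], along the three lines, vanish for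
   [a < B_p(l1)], [b < B_p(l2)], [c < B_p(l3)]; counting dimensions,
   [\sum_p B_p(l1) B_p(l2) B_p(l3)] is at least of order [n ^ 3]. Here the line
   chosen at [p] in each family is the one minimizing [B_p], so that
   [\sum_p N_i(p) B_p(l_i)] is at most of order [n L_i].
   Raise [beta] by one at any point where the product of the [B_p] exceeds a small
   multiple of [n ^ 3 (N_1 N_2 N_3 / L_1 L_2 L_3)^(1/2)]. By AM-GM, the two
   estimates show that such a point always exists, so this never stops; on a
   connected configuration every point is eventually raised, and then every
   product is at least that multiple. A second use of AM-GM bounds
   [\sum_p (N_1 N_2 N_3)^(1/2)]. *)

Require Import Defs.
From HB Require Import structures.
From mathcomp Require Import all_boot all_order all_algebra finmap.
From mathcomp Require mpoly.
From mathcomp Require Import zify ring lra.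

Set Implicit Arguments.
Unset Strict Implicit.
Unset Printing Implicit Defensive.

Import Order.TTheory GRing.Theory Num.Theory.

Local Open Scope ring_scope.


(** * Linear systems and multiplicities of roots *)

Lemma exists_kernel_vector (F : fieldType) (X : finType) (I : Type) (s : seq I)
    (phi : I -> X -> F) :
  (size s < #|X|)%N ->
  exists2 c : X -> F, (exists x, c x != 0) &
    all (fun i => \sum_x c x * phi i x == 0) s.
Proof.
move=> sX.
pose A := \matrix_(i < #|X|, j < size s) phi (tnth (in_tuple s) j) (enum_val i).
have : kermx A != 0.
  by rewrite kermx_eq0 /row_free neq_ltn (leq_ltn_trans (rank_leq_col A)).
case/rowV0Pn=> u /sub_kermxP uA /rV0Pn[i ui].
exists (fun x => u 0 (enum_rank x)).
  by exists (enum_val i); rewrite enum_valK.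
rewrite -[X in all _ X]/(tval (in_tuple s)); apply/all_tnthP => j.
apply/eqP; transitivity ((u *m A) 0 j); last by rewrite uA mxE.
rewrite mxE [RHS](reindex _ (onW_bij _ (@enum_rank_bij X))) /=.
by apply: eq_bigr => x _; rewrite mxE enum_rankK.
Qed.

(** One derivative lowers the exponent by one and turns the cofactor [q] into one whose value at [s]
    is a positive multiple of [q.[s]], nonzero in characteristic zero. *)
Lemma derivn_root_multiplicity (F : numFieldType) (s : F) (k : nat)
    (q : {poly F}) :
  ~~ root q s -> ~~ root ((('X - s%:P) ^+ k * q)^`(k)) s.
Proof.
elim: k q => [|k IHk] q qs; first by rewrite expr0 mul1r derivn0.
have -> : (('X - s%:P) ^+ k.+1 * q)^`(k.+1) =
    (('X - s%:P) ^+ k * (q *+ k.+1 + ('X - s%:P) * q^`()))^`(k).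
  rewrite derivSn derivM deriv_exp derivXsubC mul1r /= exprS.
  by congr derivn; rewrite mulrDr mulrnAl mulrnAr; congr (_ + _); ring.
apply: IHk; rewrite rootE hornerD hornerMn hornerM hornerXsubC subrr mul0r addr0.
by rewrite mulrn_eq0 /= -rootE.
Qed.

Lemma dvdp_XsubC_exp (F : numFieldType) (s : F) (m : nat) (g : {poly F}) :
  (forall a, (a < m)%N -> root g^`(a) s) -> ('X - s%:P) ^+ m %| g.
Proof.
move=> gs; have [->|g0] := eqVneq g 0; first exact: dvdp0.
have [k [q]] := multiplicity_XsubC g s; rewrite g0 /= => qs gE.
have [km|mk] := ltnP k m.
  by have := gs _ km; rewrite gE mulrC (negbTE (derivn_root_multiplicity _ qs)).
by rewrite gE dvdp_mull // dvdp_exp2l.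
Qed.

(** Powers of distinct linear factors are pairwise coprime, so their product divides [g]. *)
Lemma sum_multiplicities_le (F : fieldType) (I : eqType) (r : seq I) (s : I -> F)
    (m : I -> nat) (g : {poly F}) :
  g != 0 -> uniq r -> {in r &, injective s} ->
  (forall i, i \in r -> ('X - (s i)%:P) ^+ m i %| g) ->
  (\sum_(i <- r) m i < size g)%N.
Proof.
move=> g0 ur sinj mg.
have : \prod_(i <- r) ('X - (s i)%:P) ^+ m i %| g.
  elim: r ur sinj mg => [|i r IHr] /= => [_ _ _|/andP[ir ur] sinj mg].
    by rewrite big_nil dvd1p.
  rewrite big_cons Gauss_dvdp ?mg ?mem_head ?IHr //.
  - by move=> x y xr yr; apply: sinj; rewrite in_cons ?xr ?yr orbT.
  - by move=> x xr; apply: mg; rewrite in_cons xr orbT.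
  rewrite big_seq; apply: (big_ind (fun q => coprimep (('X - (s i)%:P) ^+ m i) q)).
  - exact: coprimep1.
  - by move=> p q cp cq; rewrite coprimepMr cp.
  move=> j jr; apply/coprimep_expl/coprimep_expr/coprimep_XsubC2.
  rewrite subr_eq0; apply: contraNneq ir => sij.
  by rewrite -(sinj j i) // in_cons ?eqxx ?jr ?orbT.
move=> /dvdp_leq -/(_ g0); apply: leq_trans.
have -> : size (\prod_(i <- r) ('X - (s i)%:P) ^+ m i) = (\sum_(i <- r) m i).+1.
  elim: r {ur sinj mg} => [|i r IHr]; first by rewrite !big_nil size_poly1.
  rewrite !big_cons size_Mmonic ?IHr ?size_exp_XsubC ?addSn ?addnS //.
    by rewrite expf_neq0 // polyXsubC_eq0.
  by apply: monic_prod => j _; apply: monic_exp; exact: monicXsubC.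
by [].
Qed.
(** * Counting conditions on polynomials *)

Module DirectionalDerivatives.
Import mpoly.
Section DirDer.
Context {n : nat} {R : numFieldType}.
Implicit Types (p q v w : 'rV[R]_n) (P Q : {mpoly R[n]}).

Definition ddir v P : {mpoly R[n]} := \sum_j v 0 j *: mderiv j P.
Definition ddirs (s : seq 'rV[R]_n) P := foldr ddir P s.
Definition eval_at q P : R := meval (q 0) P.
(** The univariate polynomial [t |-> P(p + t v)]. *)
Definition restrict_line p v P : {poly R} :=
  mmap polyC (fun j => (p 0 j)%:P + v 0 j *: 'X) P.
Definition deg_lt d P := forall m : 'X_{1..n}, (d <= mdeg m)%N -> P@_m = 0.

Lemma ddir_is_linear v : linear (ddir v).
Proof.
move=> c P Q; rewrite /ddir scaler_sumr -big_split; apply: eq_bigr => j _ /=.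
by rewrite linearP /= scalerDr !scalerA mulrC.
Qed.
HB.instance Definition _ v := GRing.isLinear.Build R {mpoly R[n]} {mpoly R[n]}
  _ (ddir v) (ddir_is_linear v).

Lemma ddirs_is_linear s : linear (ddirs s).
Proof.
by elim: s => [|v s IHs] c P Q //; rewrite /ddirs /= -!/(ddirs s _) IHs linearP.
Qed.
HB.instance Definition _ s := GRing.isLinear.Build R {mpoly R[n]} {mpoly R[n]}
  _ (ddirs s) (ddirs_is_linear s).

Lemma eval_at_is_linear q : linear_for *%R (eval_at q).
Proof. by move=> c P Q; rewrite /eval_at mevalD mevalZ. Qed.
HB.instance Definition _ q := GRing.isLinear.Build R {mpoly R[n]} R
  _ (eval_at q) (eval_at_is_linear q).

Lemma ddirC v w P : ddir v (ddir w P) = ddir w (ddir v P).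
Proof.
have E u x : ddir u (ddir x P) =
    \sum_i \sum_j (u 0 i * x 0 j) *: mderiv i (mderiv j P).
  apply: eq_bigr => i _; rewrite (linear_sum (mderiv i)) scaler_sumr.
  by apply: eq_bigr => j _; rewrite /= mderivZ scalerA.
rewrite !E exchange_big; apply: eq_bigr => i _; apply: eq_bigr => j _ /=.
by rewrite mderiv_comm mulrC.
Qed.

Lemma ddirs_cat s t P : ddirs (s ++ t) P = ddirs s (ddirs t P).
Proof. exact: foldr_cat. Qed.

Lemma ddir_ddirs v s P : ddir v (ddirs s P) = ddirs s (ddir v P).
Proof. by elim: s => //= w s <-; rewrite ddirC. Qed.

Lemma perm_ddirs s t P : perm_eq s t -> ddirs s P = ddirs t P.
Proof.
elim: s t => [|v s IHs] t; first by rewrite perm_sym => /perm_nilP ->.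
move=> vst; have vt : v \in t by rewrite -(perm_mem vst) mem_head.
case/splitPr: vt vst => t1 t2.
rewrite -[v :: t2]cat1s perm_sym perm_catCA perm_sym perm_cons => /IHs /= ->.
by rewrite !ddirs_cat /= ddir_ddirs.
Qed.

Lemma ddirM v P Q : ddir v (P * Q) = ddir v P * Q + P * ddir v Q.
Proof.
rewrite /ddir mulr_suml mulr_sumr -big_split; apply: eq_bigr => j _ /=.
by rewrite mderivM scalerDr scalerAl scalerAr.
Qed.

(** Constants and variables generate the algebra; identities between morphisms or derivations need
    checking only there. *)
Lemma mpoly_algebra_ind (K : {mpoly R[n]} -> Prop) :
  (forall c, K c%:MP) -> (forall j, K 'X_j) ->
  (forall P Q, K P -> K Q -> K (P + Q)) ->
  (forall P Q, K P -> K Q -> K (P * Q)) ->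
  forall P, K P.
Proof.
move=> KC KX KD KM; apply: mpolyind => [|c m P _ _ KP]; first exact: (KC 0).
apply: (KD _ _ _ KP); rewrite -mul_mpolyC; apply: (KM) => //.
rewrite mpolyXE_id; apply: (big_ind K) => //; first exact: (KC 1).
move=> j _; elim: (m j) => [|k IHk]; first by rewrite expr0; exact: (KC 1).
by rewrite exprS; exact: KM.
Qed.

Lemma deriv_restrict_line p v P :
  (restrict_line p v P)^`() = restrict_line p v (ddir v P).
Proof.
rewrite /restrict_line.
elim/mpoly_algebra_ind: P => [c|j|P Q PE QE|P Q PE QE].
- rewrite mmapC derivC /ddir big1 ?rmorph0 // => j _.
  by rewrite mderivC scaler0.
- rewrite mmapX mmap1U derivD derivC add0r derivZ derivX /ddir.
  rewrite (bigD1 j) //= big1 ?addr0 => [|i ij]; last first.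
    by rewrite mderivX mnm1E eq_sym (negbTE ij) scale0r scaler0.
  rewrite mderivX mnm1E eqxx scale1r.
  have -> : (U_(j) - U_(j))%MM = 0%MM :> 'X_{1..n}.
    by apply/mnmP => i; rewrite mnmBE subnn mnm0E.
  by rewrite mpolyX0 mmapZ rmorph1 alg_polyC mulr1.
- by rewrite linearD !rmorphD /= derivD PE QE.
by rewrite ddirM rmorphD !rmorphM /= derivM PE QE.
Qed.

Lemma horner_restrict_line p v P s :
  (restrict_line p v P).[s] = eval_at (p + s *: v) P.
Proof.
rewrite /restrict_line /eval_at.
elim/mpoly_algebra_ind: P => [c|j|P Q PE QE|P Q PE QE].
- by rewrite mmapC mevalC hornerC.
- by rewrite mmapX mmap1U mevalXU !hornerE !mxE mulrC.
- by rewrite rmorphD /= mevalD hornerD PE QE.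
by rewrite rmorphM /= mevalM hornerM PE QE.
Qed.

Lemma derivn_restrict_line p v P k :
  (restrict_line p v P)^`(k) = restrict_line p v (ddirs (nseq k v) P).
Proof.
by elim: k => [|k IHk]; rewrite ?derivn0 // derivnS IHk deriv_restrict_line.
Qed.

Lemma size_restrict_line p v P d :
  deg_lt d P -> (size (restrict_line p v P) <= d)%N.
Proof.
move=> Pd; rewrite /restrict_line /mmap.
rewrite big_seq; apply: (big_ind (fun g : {poly R} => (size g <= d)%N)).
- by rewrite size_poly0.
- by move=> f g fd gd; rewrite (leq_trans (size_polyD _ _)) // geq_max fd.
move=> m; rewrite mcoeff_msupp => Pm.
have md : (mdeg m < d)%N by rewrite ltnNge; apply: contra Pm => /Pd ->.
rewrite mul_polyC (leq_trans (size_scale_leq _ _)) // (leq_trans _ md) // mdegE.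
apply: (big_rec2 (fun (g : {poly R}) k => (size g <= k.+1)%N)).
  by rewrite size_poly1.
move=> j k g _ gk; rewrite (leq_trans (size_polyMleq _ _)) //.
set l := (p 0 j)%:P + _.
have l2 : (size l <= 2)%N.
  rewrite (leq_trans (size_polyD _ _)) // geq_max.
  rewrite (leq_trans (size_polyC_leq1 _)) //=.
  by rewrite (leq_trans (size_scale_leq _ _)) // size_polyX.
have : (size (l ^+ m j) <= (m j).+1)%N.
  rewrite (leq_trans (size_poly_exp_leq _ _)) // ltnS -[leqRHS]mul1n leq_mul2r.
  by rewrite -subn1 leq_subLR l2 orbT.
move=> /leq_add/(_ gk) lg; rewrite -subn1 leq_subLR (leq_trans lg) //.
by rewrite addSn addnS add1n.
Qed.

Lemma deg_lt_ddir v P d : deg_lt d P -> deg_lt d.-1 (ddir v P).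
Proof.
move=> Pd m md; rewrite /ddir raddf_sum big1 //= => j _.
rewrite mcoeffZ mcoeff_deriv Pd ?mul0rn ?mulr0 // mdegD mdeg1 addn1.
by case: d md {Pd}.
Qed.

Lemma deg_ltW P c d : (c <= d)%N -> deg_lt c P -> deg_lt d P.
Proof. by move=> cd Pc m /(leq_trans cd); exact: Pc. Qed.

Lemma deg_lt_ddirs s P d : deg_lt d P -> deg_lt d (ddirs s P).
Proof.
move=> Pd; elim: s => //= v s IHs.
by apply: deg_ltW (leq_pred d) _; exact: deg_lt_ddir.
Qed.

(** Induction on the degree: either some partial derivative is nonzero, or, in characteristic zero,
    [P] is a nonzero constant. *)
Lemma ddirs_neq0_at q P : P != 0 -> exists s, eval_at q (ddirs s P) != 0.
Proof.
have [d Pd] : exists d, deg_lt d P.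
  by exists (msize P) => m /msize_mdeg_ge/memN_msupp_eq0.
elim: d P Pd => [|d IHd] P Pd P0.
  by case/eqP: P0; apply/mpolyP => m; rewrite Pd // mcoeff0.
have [/existsP[j Pj0]|/existsPn P'0] := boolP [exists j, mderiv j P != 0].
  pose v : 'rV[R]_n := delta_mx 0 j.
  have Pj : ddir v P = mderiv j P.
    rewrite /ddir (bigD1 j) //= big1 ?addr0 ?mxE ?eqxx ?scale1r // => i ij.
    by rewrite mxE (negbTE ij) andbF scale0r.
  have [|s sP] := IHd _ _ Pj0; first by rewrite -Pj; exact: (deg_lt_ddir v Pd).
  by exists (s ++ [:: v]); rewrite ddirs_cat /= Pj.
exists [::] => /=.
have PE : P = (P@_0)%:MP.
  apply/mpolyP => m; rewrite mcoeffC; have [->|m0] := eqVneq m 0%MM.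
    by rewrite mulr1.
  have [j mj] : exists j, m j != 0%N.
    apply/existsP; apply: contraNT m0 => /existsPn m0; apply/eqP/mnmP => j.
    by rewrite mnm0E; apply/eqP; move: (m0 j); rewrite negbK.
  have := P'0 j; rewrite negbK => /eqP/mpolyP/(_ (m - U_(j))%MM).
  rewrite mcoeff_deriv mcoeff0 submK ?lep1mP // mulr0 => /eqP.
  by rewrite mulrn_eq0 => /eqP.
by rewrite PE /eval_at mevalC; apply: contraNneq P0 => P00; rewrite PE P00.
Qed.

(** Iterated derivatives are multilinear in their directions, which are expanded one at a time in
    the spanning family [b]. *)
Lemma ddirs_basis_eq0 (b : 'I_n -> 'rV[R]_n) q P k :
  (forall w, exists c : 'I_n -> R, w = \sum_i c i *: b i) ->
  (forall t, size t = k -> eval_at q (ddirs (map b t) P) = 0) ->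
  forall s, size s = k -> eval_at q (ddirs s P) = 0.
Proof.
move=> b_span tP s sk.
suff gen t : size (s ++ map b t) = k -> eval_at q (ddirs (s ++ map b t) P) = 0.
  by have := gen [::]; rewrite cats0 => ->.
elim: s t {sk} => [|w s IHs] t; first by rewrite size_map; exact: tP.
rewrite /= => stk; have [c ->] := b_span w.
have -> (Q : {mpoly R[n]}) : ddir (\sum_i c i *: b i) Q = \sum_i c i *: ddir (b i) Q.
  rewrite /ddir; under [RHS]eq_bigr do rewrite scaler_sumr.
  rewrite exchange_big; apply: eq_bigr => j _ /=; rewrite summxE scaler_suml.
  by apply: eq_bigr => i _; rewrite mxE scalerA.
rewrite linear_sum big1 // => i _; rewrite linearZ /=.
rewrite (_ : ddir _ _ = ddirs (s ++ map b (i :: t)) P); last first.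
  by rewrite !ddirs_cat /= ddir_ddirs.
by rewrite IHs ?mulr0 // -stk !size_cat /= addnS.
Qed.

End DirDer.

(** The [N ^ n] monomials with all exponents below [N] supply more coefficients than there are
    conditions, and have total degree at most [n * N]. *)
Lemma exists_box_mpoly (R : numFieldType) (n N : nat) (I : Type) (s : seq I)
    (phi : I -> {linear {mpoly R[n]} -> R | *%R}) :
  (size s < N ^ n)%N ->
  exists P, [/\ P != 0, deg_lt (n * N).+1 P & all (fun i => phi i P == 0) s].
Proof.
pose X := {ffun 'I_n -> 'I_N}; pose mon (x : X) := [multinom val (x i) | i < n].
have mon_inj : injective mon.
  by move=> x y /mnmP xy; apply/ffunP => i; apply: val_inj; have := xy i; rewrite !mnmE.
rewrite -[X in (_ < X ^ _)%N]card_ord -[X in (_ < _ ^ X)%N]card_ord -card_ffun.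
case/(exists_kernel_vector (fun i x => phi i 'X_[mon x])) => c [y cy] c0.
pose P := \sum_x c x *: 'X_[mon x] : {mpoly R[n]}.
have PE m : P@_m = \sum_x c x * (mon x == m)%:R.
  by rewrite raddf_sum; apply: eq_bigr => x _; rewrite /= mcoeffZ mcoeffX.
exists P; split.
- apply: contraNneq cy => P0; have /eqP := PE (mon y).
  rewrite P0 mcoeff0 (bigD1 y) //= eqxx mulr1 big1 ?addr0 1?eq_sym //.
  by move=> x xy; rewrite (inj_eq mon_inj) (negbTE xy) mulr0.
- move=> m mN; rewrite PE big1 // => x _.
  case: eqP => [xm|]; last by rewrite mulr0.
  suff : (mdeg (mon x) <= n * N)%N by rewrite xm leqNgt mN.
  rewrite mdegE; under eq_bigr do rewrite mnmE.
  rewrite -[n in (n * _)%N]card_ord -sum_nat_const leq_sum // => i _.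
  exact/ltnW/ltn_ord.
apply: sub_all c0 => i /eqP c0.
by rewrite linear_sum /=; under eq_bigr do rewrite linearZ; rewrite c0.
Qed.

Lemma card_ord_ltn b K : (b <= K)%N -> #|[pred j : 'I_K | (j < b)%N]| = b.
Proof.
move=> bK; rewrite -sum1_card.
by rewrite -(big_ord_widen K (fun=> 1%N) bK) sum1_card card_ord.
Qed.

(* Take [P] nonzero annihilated by all mixed derivatives in the boxes, and a
   nonvanishing mixed derivative of [P] at a point [p], of order [r], with
   [r + beta p] minimal. By minimality, stripping off the derivatives along the
   [i]-th line through [p] leaves a polynomial whose restriction to that line
   vanishes to high order at the other points of the line. *)
Lemma handicap_count (R : numFieldType) (n N : nat) (T : finType) (A : {set T})
    (pos : T -> 'rV[R]_n) (v : T -> 'I_n -> 'rV[R]_n)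
    (line : T -> 'I_n -> pred T) (crd : T -> 'I_n -> T -> R)
    (beta : T -> nat) (B : T -> 'I_n -> nat) :
  injective pos -> A != set0 ->
  (forall p, p \in A ->
     forall w, exists c : 'I_n -> R, w = \sum_i c i *: v p i) ->
  (forall p i q, p \in A -> q \in A -> line p i q ->
     pos q = pos p + crd p i q *: v p i) ->
  (forall p i a, p \in A ->
     \sum_(q in A | line p i q) (a + beta p - beta q) <= n * N -> a < B p i)%N ->
  (N ^ n <= \sum_(p in A) \prod_i B p i)%N.
Proof.
move=> pos_inj /set0Pn[p0 p0A] v_span lineP boxP; rewrite leqNgt; apply/negP => BN.
pose K := (\sum_(p in A) \sum_i B p i)%N.
have BK p i : p \in A -> (B p i <= K)%N.
  move=> pA; rewrite /K (bigD1 p) //= (bigD1 i) //= -addnA; exact: leq_addr.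
(* Derivatives commute, so an order [a] needs only one representative sequence of directions; [K]
   merely bounds all box sides, to make the orders a finite type. *)
pose can (a : {ffun 'I_n -> 'I_K}) := flatten [seq nseq (a i) i | i <- enum 'I_n].
have canE a j : count_mem j (can a) = a j.
  rewrite /can count_flatten -map_comp sumnE big_map big_enum /=.
  rewrite (bigD1 j) //= count_nseq /= eqxx mul1n big1 ?addn0 // => i ij.
  by rewrite count_nseq /= (negbTE ij).
pose box p := family (fun i => [pred j : 'I_K | (j < B p i)%N]).
pose s := [seq (p, a) | p <- enum A, a <- enum (box p)].
have : (size s < N ^ n)%N.
  apply: leq_trans BN; rewrite ltnS size_allpairs_dep sumnE big_map big_enum /=.
  rewrite leq_sum // => p pA; rewrite -cardE card_family foldrE big_map big_enum /=.
  by apply: eq_leq; apply: eq_bigr => i _; exact/card_ord_ltn/BK.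
pose phi (pa : T * {ffun 'I_n -> 'I_K}) : {linear {mpoly R[n]} -> R | *%R} :=
  eval_at (pos pa.1) \o ddirs (map (v pa.1) (can pa.2)).
case/(exists_box_mpoly phi) => P [P0 Pdeg /allP Ps].
have vanish p t : p \in A -> (forall i, count_mem i t < B p i)%N ->
    eval_at (pos p) (ddirs (map (v p) t) P) = 0.
  move=> pA tB.
  pose a := [ffun i => Ordinal (leq_trans (tB i) (BK p i pA))].
  have ta : perm_eq t (can a).
    by apply/allP => j _ /=; rewrite canE ffunE.
  rewrite (perm_ddirs _ (perm_map _ ta)); apply/eqP/(Ps (p, a)).
  apply/allpairsPdep; exists p, a; split; rewrite ?mem_enum //.
  by apply/familyP => i; rewrite ffunE inE; exact: tB.
pose nz tau := [exists p in A, (beta p <= tau)%N &&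
  [exists t : (tau - beta p).-tuple 'I_n,
     eval_at (pos p) (ddirs (map (v p) t) P) != 0]].
have nzI q t : q \in A -> eval_at (pos q) (ddirs (map (v q) t) P) != 0 ->
    nz (size t + beta q)%N.
  move=> qA qt; apply/existsP; exists q; rewrite qA leq_addl /=.
  have tk : size t == (size t + beta q - beta q)%N by rewrite addnK.
  by apply/existsP; exists (Tuple tk).
(* Vanishing along the directions at [q] gives vanishing along all directions, in particular along
   those chosen at another point. *)
have span0 q k : q \in A -> ~~ nz (k + beta q)%N ->
    forall u, size u = k -> eval_at (pos q) (ddirs u P) = 0.
  move=> qA nzq; apply: (ddirs_basis_eq0 (v_span q qA)) => t tk; apply/eqP.
  by apply: contraNT nzq => /(nzI _ _ qA); rewrite tk.
have nz_ex : exists tau, nz tau.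
  have [u u0] := ddirs_neq0_at (pos p0) P0.
  exists (size u + beta p0)%N; apply: contraNT u0 => nz0.
  by rewrite (span0 p0 (size u)).
case: (ex_minnP nz_ex) => tau /existsP[p /andP[pA /andP[ptau /existsP[t pt]]]] tau_min.
(* The derivative [t] does not vanish, so its order lies outside the box at [p]. *)
have [i Bi] : exists i, (B p i <= count_mem i t)%N.
  apply/existsP; apply: contraNT pt => /existsPn tB.
  by rewrite vanish // => i; rewrite ltnNge.
set a := count_mem i t in Bi; pose t' := [seq j <- t | j != i].
have tE : perm_eq t (nseq a i ++ t').
  apply/allP => j _ /=; rewrite count_cat count_nseq count_filter /=.
  have [<-|ij] := eqVneq i j.
    rewrite mul1n [X in (_ + X)%N](@eq_count _ _ pred0) ?count_pred0 ?addn0 //.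
    by move=> x /=; case: eqP.
  rewrite mul0n add0n; apply/eqP/eq_count => x /=.
  by case: (eqVneq x j) => // ->; rewrite eq_sym ij.
have taE : tau = (a + size t' + beta p)%N.
  have := perm_size tE; rewrite size_tuple size_cat size_nseq => <-.
  by rewrite subnK.
pose g := restrict_line (pos p) (v p i) (ddirs (map (v p) t') P).
have gE e x : g^`(e).[x] =
    eval_at (pos p + x *: v p i) (ddirs (nseq e (v p i) ++ map (v p) t') P).
  by rewrite derivn_restrict_line horner_restrict_line ddirs_cat.
have g0 : g != 0.
  apply: contraNneq pt => g0; have := gE a 0; rewrite g0 linear0 horner0 scale0r addr0.
  by rewrite (perm_ddirs _ (perm_map _ tE)) map_cat map_nseq => <-.
(* For [e < a + beta p - beta q], the [e]-th derivative of [g] at [q] has total order [e + size t'],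
   and [e + size t' + beta q < tau]; it vanishes by minimality of [tau]. *)
have : (\sum_(q in A | line p i q) (a + beta p - beta q) < size g)%N.
  rewrite -big_filter; apply: (@sum_multiplicities_le _ _ _ (crd p i)) g0 _ _ _.
  - by rewrite filter_uniq // index_enum_uniq.
  - move=> x y; rewrite !mem_filter => /andP[/andP[xA xl] _] /andP[/andP[yA yl] _] xy.
    by apply: pos_inj; rewrite (lineP p i x) // (lineP p i y) // xy.
  move=> q; rewrite mem_filter => /andP[/andP[qA ql] _].
  apply: dvdp_XsubC_exp => e ea; rewrite rootE gE -lineP // (span0 q (e + size t')%N) //.
    by apply/negP => /tau_min; rewrite taE; lia.
  by rewrite size_cat size_nseq size_map.
move/leq_trans/(_ (size_restrict_line _ _ (deg_lt_ddirs _ Pdeg))).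
by rewrite ltnS => /(boxP _ _ _ pA); rewrite ltnNge Bi.
Qed.

End DirectionalDerivatives.

(** * Inequalities for products of three factors *)

Lemma big_ord3 (S : Type) (idx : S) (op : Monoid.law idx) (f : 'I_3 -> S) :
  \big[op/idx]_i f i = op (op (f ord0) (f (lift ord0 ord0))) (f ord_max).
Proof.
rewrite !big_ord_recl big_ord0 Monoid.mulm1 Monoid.mulmA.
by congr (op _ (f _)); exact: val_inj.
Qed.

(** AM-GM: [(x + y + z) ^ 3 - 27 x y z] is three times the first nonnegative expression below plus
    half the second. *)
Lemma cube_le_prod3 (R : realFieldType) (x y z w : R) :
  0 <= x -> 0 <= y -> 0 <= z -> 0 <= w -> w ^+ 3 <= x * y * z ->
  3 * w <= x + y + z.
Proof.
move=> x0 y0 z0 w0 wxyz; rewrite -(ler_pXn2r (n := 3)) ?nnegrE ?addr_ge0 ?mulr_ge0 //.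
have : 0 <= x * (y - z) ^+ 2 + y * (z - x) ^+ 2 + z * (x - y) ^+ 2.
  by rewrite !addr_ge0 // mulr_ge0 // sqr_ge0.
have : 0 <= (x + y + z) * ((x - y) ^+ 2 + (y - z) ^+ 2 + (z - x) ^+ 2).
  by rewrite mulr_ge0 ?addr_ge0 // sqr_ge0.
by move: wxyz; rewrite !exprS !expr0; nra.
Qed.

(** Lets bounds for two separate configurations be added. After squaring, AM-GM bounds the cross
    term by two complementary mixed terms of the expanded product. *)
Lemma sqrt_prod3_superadd (R : rcfType) (x y : 'I_3 -> nat) :
  Num.sqrt ((\prod_i x i)%:R : R) + Num.sqrt ((\prod_i y i)%:R) <=
  Num.sqrt ((\prod_i (x i + y i)%N)%:R).
Proof.
rewrite -ler_sqr ?nnegrE ?addr_ge0 ?sqrtr_ge0 //.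
rewrite sqr_sqrtr ?ler0n // sqrrD !sqr_sqrtr ?ler0n //.
rewrite !natr_prod !big_ord3 /= !natrD.
set x0 : R := (x _)%:R; set x1 : R := (x _)%:R; set x2 : R := (x _)%:R.
set y0 : R := (y _)%:R; set y1 : R := (y _)%:R; set y2 : R := (y _)%:R.
have x00 : 0 <= x0 by exact: ler0n.
have x10 : 0 <= x1 by exact: ler0n.
have x20 : 0 <= x2 by exact: ler0n.
have y00 : 0 <= y0 by exact: ler0n.
have y10 : 0 <= y1 by exact: ler0n.
have y20 : 0 <= y2 by exact: ler0n.
have : Num.sqrt (x0 * x1 * x2) * Num.sqrt (y0 * y1 * y2) *+ 2 <=
    x0 * x1 * y2 + y0 * y1 * x2.
  rewrite -sqrtrM ?mulr_ge0 //.
  have -> : x0 * x1 * x2 * (y0 * y1 * y2) = (x0 * x1 * y2) * (y0 * y1 * x2) by ring.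
  rewrite sqrtrM ?mulr_ge0 //.
  have := sqr_ge0 (Num.sqrt (x0 * x1 * y2) - Num.sqrt (y0 * y1 * x2)).
  rewrite sqrrB !sqr_sqrtr ?mulr_ge0 //; lra.
have : 0 <= x0 * y1 * x2 + x0 * y1 * y2 + y0 * x1 * x2 + y0 * x1 * y2.
  by rewrite !addr_ge0 // !mulr_ge0.
lra.
Qed.

(** * Handicaps *)

Section Handicaps.
(** An abstract incidence structure with points [T], lines [U] and three families [F]; [e p i] is
    some line of the [i]-th family through [p]. *)
Context {T U : finType} (inc : T -> pred U) (F : 'I_3 -> {set U}).
Context (e : T -> 'I_3 -> U).

Section Level.
Context (n : nat) (A : {set T}).
Hypothesis e_inc : forall p i, p \in A -> (e p i \in F i) && inc p (e p i).
Implicit Types (beta : T -> nat) (l : U).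

Definition fill beta l t := (\sum_(q in A | inc q l) (t - beta q))%N.
(** The cutoff makes the maximum finite and is harmless on a line through a point [q] of [A], where
    [fill beta l t <= n] forces [t <= n + beta q]. *)
Definition level beta l : nat :=
  (\max_(t < (n + \sum_(q in A) beta q).+1 | fill beta l t <= n) t)%N.
Definition low beta p i : U :=
  [arg min_(l < e p i | (l \in F i) && inc p l) level beta l].
Definition mult p i := #|[set l in F i | inc p l]|.
Definition met i := [set l in F i | [exists q in A, inc q l]].

Lemma fill_level beta l : (fill beta l (level beta l) <= n)%N.
Proof.
have t0 : (fill beta l (ord0 : 'I_(n + \sum_(q in A) beta q).+1) <= n)%N.
  by rewrite /fill big1.
rewrite /level (bigop.bigmax_eq_arg ord0) //.
by case: arg_maxnP.
Qed.

Lemma level_max beta l q t :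
  q \in A -> inc q l -> (fill beta l t <= n)%N -> (t <= level beta l)%N.
Proof.
move=> qA ql tn.
have tb : (t < (n + \sum_(q in A) beta q).+1)%N.
  rewrite ltnS (bigD1 q) //=.
  have : (t - beta q <= n)%N.
    by apply: leq_trans tn; rewrite /fill (bigD1 q) ?qA //= leq_addr.
  by move=> h; lia.
exact: (@leq_bigmax_cond _ _ _ (Ordinal tb)).
Qed.

Lemma level_le beta l q : q \in A -> inc q l -> (level beta l <= n + beta q)%N.
Proof.
move=> qA ql; have := fill_level beta l; rewrite /fill (bigD1 q) ?qA //=; lia.
Qed.

Lemma leq_level beta beta' l q : (forall p, beta p <= beta' p)%N ->
  q \in A -> inc q l -> (level beta l <= level beta' l)%N.
Proof.
move=> le_beta qA ql; apply: level_max qA ql _.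
apply: leq_trans (fill_level beta l); apply: leq_sum => p _.
exact: leq_sub2l.
Qed.

Lemma lowP beta p i : p \in A ->
  [/\ low beta p i \in F i, inc p (low beta p i) &
   forall l, l \in F i -> inc p l -> (level beta (low beta p i) <= level beta l)%N].
Proof.
move=> pA; rewrite /low; case: arg_minnP => [|l /andP[lF pl] l_min].
  exact: e_inc.
by split=> // l' l'F pl'; apply: l_min; rewrite l'F.
Qed.

Lemma mult_gt0 p i : p \in A -> (0 < mult p i)%N.
Proof.
by move=> pA; apply/card_gt0P; exists (e p i); rewrite inE e_inc.
Qed.

Lemma met_gt0 i : A != set0 -> (0 < #|met i|)%N.
Proof.
case/set0Pn=> p pA; apply/card_gt0P; exists (e p i).
have /andP[eF pe] := e_inc i pA; rewrite inE eF /=.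
by apply/existsP; exists p; rewrite pA.
Qed.

(** Replace the lowest line at [p] by each of the [mult p i] lines through [p], then exchange the
    sums: each line contributes at most its fill plus [c] per point. *)
Lemma sum_mult_level beta i c :
  (\sum_(p in A) mult p i * (level beta (low beta p i) + c - beta p) <=
   #|met i| * (n + c * #|A|))%N.
Proof.
apply: (@leq_trans
  (\sum_(l in met i) \sum_(p in A | inc p l) (level beta l + c - beta p))%N).
  rewrite (exchange_big_dep (mem A)) /=; last by move=> l p _ /andP[].
  apply: leq_sum => p pA; rewrite /mult -sum_nat_const pA /=.
  rewrite (eq_bigl (fun l => (l \in met i) && inc p l)) => [|l]; last first.
    rewrite !inE -andbA; congr andb; case pl: (inc p l); rewrite ?andbF // andbT.
    by apply/esym/existsP; exists p; rewrite pA.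
  have [_ _ p_min] := lowP beta i pA.
  apply: leq_sum => l /andP[]; rewrite inE => /andP[lF _] pl.
  by rewrite leq_sub2r // leq_add2r p_min.
rewrite -sum_nat_const leq_sum // => l _.
apply: leq_trans (leq_add (fill_level beta l) (leqnn _)).
have cA : (\sum_(p in A | inc p l) c <= c * #|A|)%N.
  rewrite mulnC -sum_nat_const [leqRHS](bigID (inc^~ l)) /=; exact: leq_addr.
apply: leq_trans (leq_add (leqnn _) cA).
rewrite /fill -big_split /=; apply: leq_sum => p _.
lia.
Qed.

End Level.

(** * Connected configurations *)

Section Connected.
Context (R : rcfType) (A : {set T}) (N : nat).
Hypothesis e_inc : forall p i, p \in A -> (e p i \in F i) && inc p (e p i).
Hypothesis A_neq0 : A != set0.
Hypothesis N_large : (252 * #|A| < N)%N.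
Let n := (3 * N)%N.
Hypothesis count : forall beta,
  (N ^ 3 <= \sum_(p in A) \prod_i (level n A beta (low n A beta p i) + 1 - beta p))%N.
Hypothesis conn : forall C : {set T}, C != set0 -> C \proper A ->
  exists p q i l, [/\ p \in A :\: C, q \in C, l \in F i, inc p l & inc q l].
Implicit Types (beta : T -> nat) (p : T).

(** [width] is the [B_p] of the overview. [depth] is a lower bound for the width at [p] after
    [beta p] is raised by one, and [sum_mult_level] bounds its weighted sum with [c = 0]. *)
Let width beta p i := (level n A beta (low n A beta p i) + 1 - beta p)%N.
Let depth beta p i := (level n A beta (low n A beta p i) - beta p)%N.
Let wt p := (\prod_i mult p i)%N.
Let Lam := (\prod_i #|met A i|)%N.

Let cardA_gt0 : (0 < #|A|)%N. Proof. by rewrite card_gt0. Qed.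
Let Lam_gt0 : (0 < Lam)%N.
Proof. by rewrite prodn_gt0 // => i; exact: met_gt0. Qed.
Let wt_gt0 p : p \in A -> (0 < wt p)%N.
Proof. by move=> pA; rewrite prodn_gt0 // => i; exact: mult_gt0 e_inc _ _ pA. Qed.

Lemma sum_normalized_le1 (X : T -> 'I_3 -> nat) (M : nat) (i : 'I_3) :
  (0 < M)%N -> (\sum_(p in A) mult p i * X p i <= #|met A i| * M)%N ->
  \sum_(p in A) ((mult p i)%:R * (X p i)%:R / (M%:R * #|met A i|%:R)) <= 1 :> R.
Proof.
move=> M0 XM; rewrite -mulr_suml ler_pdivrMr ?mul1r.
  under eq_bigr do rewrite -natrM.
  by rewrite -natr_sum -natrM ler_nat mulnC.
by rewrite mulr_gt0 ?ltr0n // (met_gt0 e_inc).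
Qed.

(* If all the products were below the threshold, AM-GM would give
   [4 * \sum_p \prod_i depth <= 3 * N ^ 3], against [count]. *)
Lemma exists_deep beta :
  exists2 p, p \in A & (N ^ 6 * wt p <= 64 * (\prod_i depth beta p i) ^ 2 * Lam)%N.
Proof.
apply/exists_inP; apply: contraT => /exists_inPn no_deep.
have depth_le p i : p \in A -> (depth beta p i <= n)%N.
  move=> pA; have [_ pl _] := lowP n e_inc beta i pA.
  by have := level_le n beta pA pl; rewrite /depth; lia.
have N0 : (0 < N)%N by exact: leq_ltn_trans N_large.
have n0 : (0 < n)%N by rewrite muln_gt0.
(* With [y] the product of depths, the three terms multiply to [wt p * y / (27 N ^ 3 Lam)]; this is
   at least [(4 y / (3 N ^ 3)) ^ 3] exactly when [64 y ^ 2 Lam <= N ^ 6 * wt p]. *)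
have y_le p : p \in A -> 3 * (4 * (\prod_i depth beta p i)%:R / (3 * N%:R ^+ 3)) <=
    \sum_i ((mult p i)%:R * (depth beta p i)%:R / (n%:R * #|met A i|%:R)) :> R.
  move=> pA; set y := (\prod_i depth beta p i)%N.
  have yw : 64%:R * y%:R ^+ 2 * Lam%:R <= N%:R ^+ 6 * (wt p)%:R :> R.
    by rewrite -!natrX -!natrM ler_nat ltnW // ltnNge no_deep.
  have lam_pos : 0 < Lam%:R :> R by rewrite ltr0n.
  have N_pos : 0 < N%:R :> R by rewrite ltr0n.
  rewrite big_ord3 /=.
  apply: cube_le_prod3; rewrite ?divr_ge0 ?mulr_ge0 ?exprn_ge0 ?ler0n //.
  set i1 := lift _ _.
  have yE : y%:R = (depth beta p ord0)%:R * (depth beta p i1)%:R *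
      (depth beta p ord_max)%:R :> R.
    by rewrite /y natr_prod big_ord3.
  have wE : (wt p)%:R = (mult p ord0)%:R * (mult p i1)%:R * (mult p ord_max)%:R :> R.
    by rewrite /wt natr_prod big_ord3.
  have LE : Lam%:R = #|met A ord0|%:R * #|met A i1|%:R * #|met A ord_max|%:R :> R.
    by rewrite /Lam natr_prod big_ord3.
  have nE : n%:R = 3 * N%:R :> R by rewrite natrM.
  have -> : (mult p ord0)%:R * (depth beta p ord0)%:R / (n%:R * #|met A ord0|%:R) *
     ((mult p i1)%:R * (depth beta p i1)%:R / (n%:R * #|met A i1|%:R)) *
     ((mult p ord_max)%:R * (depth beta p ord_max)%:R / (n%:R * #|met A ord_max|%:R))
     = (wt p)%:R * y%:R / (27 * N%:R ^+ 3 * Lam%:R) :> R.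
    rewrite yE wE LE nE; field.
    by rewrite !pnatr_eq0 !gtn_eqF // !(met_gt0 e_inc).
  rewrite ler_pdivlMr ?mulr_gt0 ?exprn_gt0 // expr_div_n mulrAC ler_pdivrMr; last first.
    by rewrite exprn_gt0 // mulr_gt0 // exprn_gt0.
  rewrite (_ : _ * _ = 27 * N%:R ^+ 3 * y%:R * (64%:R * y%:R ^+ 2 * Lam%:R));
    last by ring.
  rewrite [leRHS](_ : _ = 27 * N%:R ^+ 3 * y%:R * (N%:R ^+ 6 * (wt p)%:R)); last by ring.
  by rewrite ler_wpM2l // !mulr_ge0 ?exprn_ge0 ?ler0n.
have y_sum : (4 * \sum_(p in A) \prod_i depth beta p i <= 3 * N ^ 3)%N.
  have : \sum_(p in A) 3 * (4 * (\prod_i depth beta p i)%:R / (3 * N%:R ^+ 3)) <= 3 :> R.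
    apply: le_trans (ler_sum _ y_le) _; rewrite exchange_big /=.
    rewrite [leRHS](_ : _ = \sum_(i < 3) 1); last by rewrite sumr_const card_ord.
    apply: ler_sum => i _.
    apply: sum_normalized_le1 => //.
    have := sum_mult_level n e_inc beta i 0; rewrite mul0n addn0.
    by under eq_bigr do rewrite addn0.
  rewrite -mulr_sumr -mulr_suml -mulr_sumr -natr_sum.
  move: (\sum_(p in A) _)%N => S SN.
  suff : 4%:R * S%:R <= 3%:R * N%:R ^+ 3 :> R by rewrite -natrX -!natrM ler_nat.
  move: SN.
  have N3 : 0 < N%:R ^+ 3 :> R by rewrite exprn_gt0 // ltr0n.
  rewrite mulrA ler_pdivrMr ?exprn_gt0 ?mulr_gt0 ?ltr0n //; lra.
(* Passing from depths, each at most [3 N], to widths costs at most [63 N ^ 2] per point. As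
   [4 * 63 = 252], [N_large] keeps the total below [N ^ 3 / 4], the slack left by [y_sum]. *)
have : (\sum_(p in A) \prod_i width beta p i <=
    \sum_(p in A) (\prod_i depth beta p i + 63 * N ^ 2))%N.
  apply: leq_sum => p pA.
  have wd i : (width beta p i <= (depth beta p i).+1)%N by rewrite /width /depth; lia.
  apply: leq_trans (leq_prod (fun i _ => wd i)) _.
  rewrite !big_ord3 /=.
  have := depth_le p ord0 pA; have := depth_le p (lift ord0 ord0) pA.
  have := depth_le p ord_max pA; rewrite /n.
  move: (depth beta p _) (depth beta p _) (depth beta p _) => a b c aN bN cN.
  have ab : (a * b <= (3 * N) * (3 * N))%N by exact: leq_mul.
  have ac : (a * c <= (3 * N) * (3 * N))%N by exact: leq_mul.
  have bc : (b * c <= (3 * N) * (3 * N))%N by exact: leq_mul.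
  by rewrite expnS expn1; nia.
rewrite big_split /= sum_nat_const.
have := count beta; rewrite -/(width beta _ _) => cN wN.
have {cN wN} := leq_trans cN wN.
move: y_sum; move: (\sum_(p in A) _)%N => S.
rewrite !expnS expn0 muln1; move: N_large N0; clear; nia.
Qed.

(* The constants encode
   [\prod_i width >= N ^ 3 * sqrt (wt p) / (8 * sqrt Lam)] without roots. *)
Let balanced beta := forall p, p \in A -> (0 < beta p)%N ->
  (N ^ 6 * wt p <= 64 * (\prod_i width beta p i) ^ 2 * Lam)%N.

(** Raise [beta] at a deep point again and again. Levels never decrease, so the widths elsewhere do
    not shrink, and the new width at the raised point is at least its old depth. *)
Lemma exists_large_balanced k :
  exists2 beta, balanced beta & (k <= \sum_(p in A) beta p)%N.
Proof.
elim: k => [|k [beta bal_beta k_le]]; first by exists (fun=> 0%N) => // p _.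
have [p pA p_deep] := exists_deep beta.
pose beta' q := (beta q + (q == p))%N.
have beta_le q : (beta q <= beta' q)%N by exact: leq_addr.
have level_le' q i : q \in A ->
    (level n A beta (low n A beta q i) <= level n A beta' (low n A beta' q i))%N.
  move=> qA; have [_ _ q_min] := lowP n e_inc beta i qA.
  have [lF ql _] := lowP n e_inc beta' i qA.
  exact: leq_trans (q_min _ lF ql) (leq_level n beta_le qA ql).
exists beta' => [q qA q0|]; last first.
  apply: leq_ltn_trans k_le _; rewrite (bigD1 p) //= [ltnRHS](bigD1 p) //=.
  rewrite -addSn leq_add //; first by rewrite /beta' eqxx addn1.
  by apply: leq_sum.
have [qp|qp] := eqVneq q p.
  rewrite {q q0 qA}qp; apply: leq_trans p_deep _.
  rewrite leq_mul2r leq_mul2l leq_exp2r // leq_prod ?orbT // => i _.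
  by have := level_le' p i pA; rewrite /depth /width /beta' eqxx; lia.
have bq : beta' q = beta q by rewrite /beta' (negbTE qp) addn0.
rewrite bq in q0; apply: leq_trans (bal_beta q qA q0) _.
rewrite leq_mul2r leq_mul2l leq_exp2r // leq_prod ?orbT // => i _.
by have := level_le' q i qA; rewrite /width bq; lia.
Qed.

(* If [beta] vanishes somewhere, connectedness bounds it: at a point [p] with
   [beta p > 0], balancedness forces [beta p <= n + beta q] for every [q] sharing
   a line with [p]. *)
Lemma exists_positive_balanced :
  exists2 beta, balanced beta & forall p, p \in A -> (0 < beta p)%N.
Proof.
have [beta bal_beta large] := exists_large_balanced (n * #|A| * #|A|).+1.
exists beta => // q0 q0A; rewrite lt0n; apply/eqP => beta0.
(* Each layer gains a point until [A] is exhausted, so [beta <= n * #|A|] throughout, contradicting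
   the choice of [large]. *)
pose C j := [set q in A | (beta q <= n * j)%N].
have CA j : C j \subset A by apply/fintype.subsetP => q; rewrite inE => /andP[].
have C_card j : (minn j.+1 #|A| <= #|C j|)%N.
  elim: j => [|j IHj].
    rewrite geq_min; apply/orP; left; apply/card_gt0P; exists q0.
    by rewrite inE q0A beta0.
  have C_sub : C j \subset C j.+1.
    apply/fintype.subsetP => q; rewrite !inE => /andP[-> /leq_trans]; apply.
    by rewrite leq_mul2l leqnSn orbT.
  have [AC|CnA] := boolP (A \subset C j).
    by rewrite geq_min (leq_trans (subset_leq_card AC)) ?orbT // subset_leq_card.
  have : C j != set0 by apply/set0Pn; exists q0; rewrite inE q0A beta0.
  have Cprop : C j \proper A by rewrite properE CA.
  case/conn/(_ Cprop) => p [q [i [l [/setDP[pA pC] qC lF pl ql]]]].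
  have [qA {}qC] : q \in A /\ (beta q <= n * j)%N.
    by move: qC; rewrite inE => /andP.
  have pC' : (n * j < beta p)%N by move: pC; rewrite inE pA /= ltnNge.
  (* Otherwise a width at [p] is zero, and balancedness fails since [N] and [wt p] are positive. *)
  have p_low : (beta p <= level n A beta (low n A beta p i))%N.
    have := bal_beta p pA (leq_ltn_trans (leq0n _) pC').
    case: (ltnP (level n A beta (low n A beta p i)) (beta p)) => // h.
    have -> : (\prod_i0 width beta p i0 = 0)%N.
      rewrite (bigD1 i) //= [width beta p i](_ : _ = 0%N) ?mul0n //.
      by apply/eqP; rewrite subn_eq0 addn1.
    rewrite exp0n // muln0 mul0n leqNgt muln_gt0 expn_gt0 wt_gt0 //.
    by rewrite (leq_ltn_trans _ N_large).
  have [_ _ p_min] := lowP n e_inc beta i pA.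
  have pj : p \in C j.+1.
    rewrite inE pA /= mulnS (leq_trans p_low) //.
    rewrite (leq_trans (p_min l lF pl)) // (leq_trans (level_le n beta qA ql)) //.
    by rewrite leq_add2l.
  have /proper_card : C j \proper C j.+1.
    by apply/properP; split => //; exists p => //; rewrite inE pA /= leqNgt pC'.
  by move: IHj; clear; lia.
have CE : C #|A| = A.
  by apply/eqP; rewrite eqEcard CA (leq_trans _ (C_card _)) // leq_min leqnSn leqnn.
move: large; rewrite ltnNge => /negP; apply.
rewrite mulnC -[X in (X * _)%N]/(#|A|) -sum_nat_const leq_sum // => p.
by rewrite -[in p \in A]CE inE => /andP[].
Qed.

(** With all handicaps positive, balancedness holds at every point, and AM-GM bounds each root by
    the normalized widths. The denominator [4 * N] absorbs the total [n + #|A|] from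
    [sum_mult_level] with [c = 1]. *)
Lemma connected_sum_le :
  \sum_(p in A) Num.sqrt ((\prod_i mult p i)%:R : R) <=
    8 * Num.sqrt ((\prod_i #|met A i|)%:R).
Proof.
rewrite -/Lam; under eq_bigr do rewrite -/(wt _).
have [beta bal_beta beta_gt0] := exists_positive_balanced.
have N0 : (0 < N)%N by exact: leq_ltn_trans N_large.
have lam_pos : 0 < Lam%:R :> R by rewrite ltr0n.
have N_pos : 0 < N%:R :> R by rewrite ltr0n.
set z := Num.sqrt (Lam%:R : R).
have z_pos : 0 < z by rewrite sqrtr_gt0.
have zE : Lam%:R = z ^+ 2 by rewrite sqr_sqrtr // ltW.
have u_le p : p \in A -> 3 * (Num.sqrt (wt p)%:R / (8 * z)) <=
    \sum_i ((mult p i)%:R * (width beta p i)%:R / ((4 * N)%:R * #|met A i|%:R)) :> R.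
  move=> pA; set u := Num.sqrt _; set y := (\prod_i width beta p i)%N.
  have u_ge0 : 0 <= u by rewrite sqrtr_ge0.
  have uE : (wt p)%:R = u ^+ 2 by rewrite sqr_sqrtr // ler0n.
  have yw : N%:R ^+ 3 * u <= 8 * y%:R * z.
    rewrite -ler_sqr ?nnegrE ?mulr_ge0 ?exprn_ge0 ?ler0n ?(ltW z_pos) //.
    rewrite [leLHS](_ : _ = N%:R ^+ 6 * u ^+ 2); last by ring.
    rewrite [leRHS](_ : _ = 64%:R * y%:R ^+ 2 * z ^+ 2); last by ring.
    rewrite -uE -zE.
    by rewrite -!natrX -!natrM ler_nat bal_beta // beta_gt0.
  rewrite big_ord3 /=.
  apply: cube_le_prod3; rewrite ?divr_ge0 ?mulr_ge0 ?ler0n ?(ltW z_pos) //.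
  set i1 := lift _ _.
  have yE : y%:R = (width beta p ord0)%:R * (width beta p i1)%:R *
      (width beta p ord_max)%:R :> R.
    by rewrite /y natr_prod big_ord3.
  have wE : u ^+ 2 = (mult p ord0)%:R * (mult p i1)%:R * (mult p ord_max)%:R :> R.
    by rewrite -uE /wt natr_prod big_ord3.
  have LE : z ^+ 2 = #|met A ord0|%:R * #|met A i1|%:R * #|met A ord_max|%:R :> R.
    by rewrite -zE /Lam natr_prod big_ord3.
  rewrite (_ : (4 * N)%:R = 4 * N%:R); last by rewrite natrM.
  rewrite [leRHS](_ : _ = u ^+ 2 * y%:R / (64 * N%:R ^+ 3 * z ^+ 2)); last first.
    rewrite yE wE LE; field.
    by rewrite !pnatr_eq0 !gtn_eqF // !(met_gt0 e_inc).
  rewrite ler_pdivlMr ?mulr_gt0 ?exprn_gt0 // expr_div_n mulrAC.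
  rewrite ler_pdivrMr ?exprn_gt0 ?mulr_gt0 //.
  rewrite [leLHS](_ : _ = 64 * u ^+ 2 * z ^+ 2 * (N%:R ^+ 3 * u)); last by ring.
  rewrite [leRHS](_ : _ = 64 * u ^+ 2 * z ^+ 2 * (8 * y%:R * z)); last by ring.
  by rewrite ler_wpM2l // !mulr_ge0 ?exprn_ge0 ?(ltW z_pos).
have : \sum_(p in A) 3 * (Num.sqrt (wt p)%:R / (8 * z)) <= 3 :> R.
  apply: le_trans (ler_sum _ u_le) _; rewrite exchange_big /=.
  rewrite [leRHS](_ : _ = \sum_(i < 3) 1); last by rewrite sumr_const card_ord.
  apply: ler_sum => i _; apply: sum_normalized_le1; first by rewrite muln_gt0.
  apply: leq_trans (sum_mult_level n e_inc beta i 1) _.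
  by rewrite leq_mul2l mul1n; apply/orP; right; move: N_large; rewrite /n; clear; lia.
rewrite -mulr_sumr -mulr_suml -[leRHS]mulr1 ler_pM2l // ler_pdivrMr ?mul1r //.
by rewrite mulr_gt0.
Qed.

End Connected.

(* The inductive step splits [A] into two parts no line of which meets both. *)
Lemma sum_sqrt_mult_le (R : rcfType) (A : {set T}) :
  (forall p i, p \in A -> (e p i \in F i) && inc p (e p i)) ->
  (forall (C : {set T}) (N : nat) (beta : T -> nat) (lam : T -> 'I_3 -> U),
     C != set0 -> C \subset A ->
     (forall p i, p \in C -> (lam p i \in F i) && inc p (lam p i)) ->
     N ^ 3 <= \sum_(p in C) \prod_i (level (3 * N) C beta (lam p i) + 1 - beta p))%N ->
  \sum_(p in A) Num.sqrt ((\prod_i mult p i)%:R : R) <=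
    8 * Num.sqrt ((\prod_i #|met A i|)%:R).
Proof.
move: {2}#|A|.+1 (ltnSn #|A|) => k; elim: k A => // k IHk A Ak e_inc count.
have [->|A0] := eqVneq A set0.
  by rewrite big_set0 mulr_ge0 ?sqrtr_ge0.
pose linked (C : {set T}) :=
  [exists p in A :\: C, exists q in C, exists i, exists l in F i, inc p l && inc q l].
have [/existsP[C /and3P[C0 CA unlinked]]|/existsPn conn] :=
    boolP [exists C : {set T}, [&& C != set0, C \proper A & ~~ linked C]]; last first.
  apply: (@connected_sum_le _ _ (253 * #|A|) e_inc A0) => [|beta|C C0 CA].
  - by rewrite ltn_pmul2r ?card_gt0.
  - apply: count => // p i pA.
    by have [-> ->] := lowP (3 * (253 * #|A|)) e_inc beta i pA.
  have := conn C; rewrite C0 CA /= negbK.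
  case/exists_inP=> p pAC /exists_inP[q qC /existsP[i /exists_inP[l lF /andP[pl ql]]]].
  by exists p, q, i, l.
have CsubA : C \subset A := proper_sub CA.
have DsubA : A :\: C \subset A := subsetDl A C.
have cardD : (#|A| = #|C| + #|A :\: C|)%N.
  by rewrite -(cardsID C A) (setIidPr CsubA).
have IH (D : {set T}) : D \subset A -> (#|D| < k)%N ->
    \sum_(p in D) Num.sqrt ((\prod_i mult p i)%:R : R) <=
      8 * Num.sqrt ((\prod_i #|met D i|)%:R).
  move=> /fintype.subsetP DA Dk; apply: IHk => // [p i pD|E N beta lam E0 ED].
    exact/e_inc/DA.
  by apply: count => //; apply: fintype.subset_trans ED _; exact/fintype.subsetP.
rewrite (big_setID C) /= (setIidPr CsubA).
have D0 : A :\: C != set0 by rewrite setD_eq0; case/andP: CA.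
apply: le_trans (lerD (IH C CsubA _) (IH _ DsubA _)) _.
- by move: (proper_card CA) Ak; rewrite ltnS; exact: leq_trans.
- rewrite -ltnS; apply: leq_trans Ak; rewrite ltnS cardD -addn1 addnC leq_add2r.
  by rewrite card_gt0.
(* No line meets both parts, so [met C i] and [met (A :\: C) i] are disjoint subsets of [met A i]
   and their sizes add. *)
rewrite -mulrDr ler_wpM2l // (le_trans (sqrt_prod3_superadd _ _ _)) //.
rewrite ler_wsqrtr // ler_nat leq_prod // => i _.
rewrite -cardsUI (_ : met C i :&: met (A :\: C) i = set0) ?cards0 ?addn0.
  apply/subset_leq_card/fintype.subsetP => l; rewrite !inE.
  by case/orP => /andP[-> /exists_inP[p pD pl]] /=; apply/exists_inP; exists p => //;
    move: pD; exact/fintype.subsetP.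
apply/setP => l; rewrite !inE; apply/negP.
case/andP => /andP[lF /exists_inP[q qC ql]] /andP[_ /exists_inP[p pD pl]].
case/negP: unlinked; apply/exists_inP; exists p => //; apply/exists_inP; exists q => //.
by apply/existsP; exists i; apply/exists_inP; exists l => //; rewrite pl.
Qed.

End Handicaps.

(* Application to multijoints of lines in space *)
From mathcomp Require Import all_classical all_reals.

Local Open Scope fset_scope.
Local Open Scope classical_set_scope.
Local Open Scope ring_scope.

Lemma card_fset_sub_type (K : choiceType) (X : {fset K}) (P : pred K) :
  #|[set l : X | P (val l)]%SET| = #|` [fset x in X | P x]|.
Proof.
rewrite cardE -(size_map val); apply/perm_size/uniq_perm.
- by rewrite map_inj_uniq ?enum_uniq //; exact: val_inj.
- exact: fset_uniq.
move=> x; rewrite !inE /=; apply/mapP/andP => [[l]|[xX Px]].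
  by rewrite mem_enum inE => Pl ->; split=> //; exact: valP.
by exists [` xX] => //; rewrite mem_enum inE.
Qed.

(** Every line is reparametrized from the common point [x], the form in which the polynomial count
    uses lines. *)
Lemma directions_span_coord (R : realType) (l : 'I_3 -> set 'rV[R]_3)
    (x : 'rV[R]_3) :
  directions_span l -> (forall i, l i x) ->
  exists v : 'I_3 -> 'rV[R]_3,
    (forall w, exists c : 'I_3 -> R, w = \sum_i c i *: v i) /\
    (forall i y, l i y -> exists t, y = x + t *: v i).
Proof.
move=> [v [dv sv]] lx; exists v; split=> [w|i y].
  have : w \in <<[tuple v i | i < 3]>>%VS by rewrite sv memvf.
  move/coord_span => {1}->; exists (fun i => coord [tuple v i | i < 3] i w).
  by apply: eq_bigr => i _; rewrite -tnth_nth tnth_mktuple.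
have [_ [p lE]] := dv i; move: (lx i); rewrite lE => -[s _ <-] [t _ <-].
by exists (t - s); rewrite scalerBl addrA addrAC addrK.
Qed.

Theorem theorem1p2p3 (R : realType) :
  exists c : R,
  forall (L : 'I_3 -> {fset set 'rV[R]_3}) (m : 'I_3),
    (forall (i : 'I_3) (l : set 'rV[R]_3), l \in L i -> is_line l) ->
    (forall (l : 'I_3 -> set 'rV[R]_3) (x : 'rV[R]_3),
       (forall i, l i \in L i) -> (forall i, l i x) -> directions_span l) ->
    (forall i : 'I_3, (#|` L m| <= #|` L i|)%N) ->
    \sum_(x \in [set x | multijoint L x /\ (10 ^ 12 < nlines (L m) x)%N])
       Num.sqrt ((\prod_(i < 3) nlines (L i) x)%N%:R : R)
    <= c * Num.sqrt ((\prod_(i < 3) #|` L i|)%N%:R : R).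
Proof.
exists 8 => L m _ generic _.
pose J := fset_set (multijoint L).
pose Lall := (\bigcup_(i <- enum 'I_3) L i)%fset.
have LallP i l : l \in L i -> l \in Lall.
  by move=> lL; apply/bigfcupP; exists i; rewrite ?mem_enum.
pose inc (p : J) (l : Lall) := val p \in val l.
pose F i : {set Lall} := [set l | val l \in L i]%SET.
have /choice[e eP] (p : J) : exists e : 'I_3 -> Lall,
    forall i, (e i \in F i) && inc p (e i).
  have : multijoint L (val p).
    by have := valP p; rewrite in_fset_set ?inE //; exact: finite_multijoint.
  case=> l [lL lx _]; exists (fun i => [` LallP _ _ (lL i)]) => i.
  by rewrite inE lL /inc /= mem_set.
have e_inc p i : p \in [set: J]%SET -> (e p i \in F i) && inc p (e p i) by [].
have count (C : {set J}) (N : nat) (beta : J -> nat) (lam : J -> 'I_3 -> Lall) :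
    C != finset.set0 -> C \subset [set: J]%SET ->
    (forall p i, p \in C -> (lam p i \in F i) && inc p (lam p i)) ->
    (N ^ 3 <= \sum_(p in C)
       \prod_i (level inc (3 * N) C beta (lam p i) + 1 - beta p))%N.
  move=> C0 _ lamP.
  (* Genericity makes any three chosen lines through [p], one from each family, span; this is what
     allows [lam] to be arbitrary. Points outside [C] get the dummy value 0. *)
  have /choice[v vP] (p : J) : exists v : 'I_3 -> 'rV[R]_3, p \in C ->
      (forall w, exists c : 'I_3 -> R, w = \sum_i c i *: v i) /\
      (forall i q, inc q (lam p i) -> exists t, val q = val p + t *: v i).
    have [pC|] := boolP (p \in C); last by exists (fun=> 0).
    have lF i : val (lam p i) \in L i by have /andP[] := lamP p i pC; rewrite inE.
    have pl i : val (lam p i) (val p).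
      by have /andP[_] := lamP p i pC; rewrite /inc inE.
    have [v [v_span v_line]] := directions_span_coord (generic _ _ lF pl) pl.
    by exists v => _; split=> // i q; rewrite /inc inE => /v_line.
  have /choice[crd crdP] (piq : J * 'I_3 * J) : exists t,
      piq.1.1 \in C -> inc piq.2 (lam piq.1.1 piq.1.2) ->
      val piq.2 = val piq.1.1 + t *: v piq.1.1 piq.1.2.
    case: piq => -[p i] q /=; have [pC|] := boolP (p \in C); last by exists 0.
    have [ql|] := boolP (inc q (lam p i)); last by exists 0.
    by have [_ /(_ i q ql)[t qE]] := vP p pC; exists t.
  apply: (@DirectionalDerivatives.handicap_count R 3 N J C val v
    (fun p i q => inc q (lam p i)) (fun p i q => crd (p, i, q)) beta) => //.
  - by move=> p /vP[].
  - by move=> p i q pC _ ql; exact: (crdP (p, i, q)).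
  (* The hypothesis says that [a + beta p] fills the line to at most [3 * N], so it is at most the
     level; the added one makes the inequality strict. *)
  move=> p i a pC le_a; have /andP[_ pl] := lamP p i pC.
  by rewrite addn1 ltn_subRL ltnS addnC (level_max pC pl le_a).
have main := sum_sqrt_mult_le R e_inc count.
have multE p i : mult inc F p i = nlines (L i) (val p).
  rewrite /nlines (_ : [fset l in L i | _] =
    [fset l in Lall | (l \in L i) && (val p \in l)])%fset; last first.
    apply/fsetP => l; rewrite !inE /=.
    by case lL: (l \in L i); rewrite ?andbF //= (LallP i l lL).
  by rewrite -card_fset_sub_type; apply: eq_card => l; rewrite !inE.
have met_le i : (#|met inc F [set: J]%SET i| <= #|` L i|)%N.
  rewrite (_ : L i = [fset l in Lall | l \in L i])%fset; last first.
    apply/fsetP => l; rewrite !inE /=.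
    by case lL: (l \in L i); rewrite ?andbF //= (LallP i l lL).
  rewrite -card_fset_sub_type; apply/subset_leq_card/fintype.subsetP => l.
  by rewrite !inE => /andP[].
rewrite fsbig_finite /=; last first.
  by apply: sub_finite_set (finite_multijoint L) => x [].
set D := fset_set _.
have DJ x : x \in D -> x \in J.
  rewrite /D /J !in_fset_set ?inE; first by case.
    exact: finite_multijoint.
  by apply: sub_finite_set (finite_multijoint L) => y [].
pose u x : R := Num.sqrt (\prod_(i < 3) nlines (L i) x)%:R.
have -> : \sum_(x <- D) u x = \sum_(x <- J | x \in D) u x.
  rewrite -[RHS]big_filter; apply/perm_big/uniq_perm; rewrite ?filter_uniq ?fset_uniq //.
  by move=> x; rewrite mem_filter; case xD: (x \in D); rewrite //= DJ.
(* The terms are nonnegative, so the sum extends from [D] to [J], where [main] applies. *)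
apply: (@le_trans _ _ (\sum_(x <- J) u x)).
  by rewrite big_mkcond; apply: ler_sum => x _; case: ifP => // _; exact: sqrtr_ge0.
rewrite big_seq_fsetE /=; apply: le_trans (le_trans main _).
  rewrite le_eqVlt; apply/orP; left; apply/eqP; apply: eq_big => [p|p _]; rewrite ?inE //.
  by congr (Num.sqrt _%:R); apply: eq_bigr => i _; rewrite multE.
rewrite ler_wpM2l // ler_wsqrtr // ler_nat leq_prod // => i _.
Qed.
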